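(* For each integer $r\ge1$, $$\lim_{u\to\infty}\frac{Q_r(u)}{\mathbf P(\chi_r\ge u)}=\frac{2e^3}{9}.$$ (In this sense $2e^3/9$ is the best possible constant in the inequality $Q_r(u)<\frac{2e^3}{9}\mathbf P(\chi_r\ge u)$, $u\ge0$.)
   Context: $C^2_{conv}$ is the class of all even functions $f:\mathbb R\to\mathbb R$ having a finite and convex second derivative $f''$ on $\mathbb R$. $C^2_{\uparrow,conv}$ is the class of all $f\in C^2_{conv}$ with $f(0)\ge0$ and $f''(0)\ge0$. $\chi_r$ is the nonnegative square root of a random variable having the chi-square distribution with $r$ degrees of freedom. For $u\ge0$, $$Q_r(u)=\inf\{\mathbf E f(\chi_r)/f(u):\ f\in C^2_{\uparrow,conv},\ f(u)>0\}.$$ *)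

(* Defs.v *)
From HB Require Import structures.
From mathcomp Require Import all_boot all_order all_algebra.
From mathcomp Require Import all_classical all_reals all_analysis.

Set Implicit Arguments.
Unset Strict Implicit.
Unset Printing Implicit Defensive.

Import Order.TTheory GRing.Theory Num.Theory.
Import numFieldNormedType.Exports.

Local Open Scope classical_set_scope.
Local Open Scope ring_scope.

(* C^2_conv *)
Definition C2conv (R : realType) (f : R -> R) : Prop :=
  [/\ forall x, f (- x) = f x,
      forall x, derivable f x 1,
      forall x, derivable (f^`()%classic) x 1
    & convex_function [set: R^o] f^`(2)%classic].

(* C^2_{\uparrow,conv} *)
Definition C2upconv (R : realType) (f : R -> R) : Prop :=
  [/\ C2conv f, 0 <= f 0 & 0 <= f^`(2)%classic 0].

Definition Gamma (R : realType) (a : R) : R :=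
  \int[lebesgue_measure]_(t in `]0, +oo[) (t `^ (a - 1) * expR (- t)).

Definition chi_square_pdf (R : realType) (r : nat) : R -> R :=
  (fun x => x `^ (r%:R / 2 - 1) * expR (- x / 2)
            / (2 `^ (r%:R / 2) * Gamma (r%:R / 2))) \_ `]0, +oo[.

Definition chi_square_distributed (d : measure_display) (T : measurableType d)
    (R : realType) (P : probability T R) (r : nat) (X : {RV P >-> R}) : Prop :=
  forall A : set R, measurable A ->
    distribution P X A =
      (\int[lebesgue_measure]_(x in A) (chi_square_pdf r x)%:E)%E.

(* The expectation in the numerator may be +oo, hence the values in \bar R. *)
Definition Q (d : measure_display) (T : measurableType d) (R : realType)
    (P : probability T R) (chi : T -> R) (u : R) : \bar R :=
  ereal_inf [set ('E_P[f \o chi] / (f u)%:E)%E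
            | f in [set f : R -> R | C2upconv f /\ 0 < f u]].

(* Main.v *)
Require Import Defs.
From HB Require Import structures.
From mathcomp Require Import all_boot all_order all_algebra.
From mathcomp Require Import all_classical all_reals all_analysis.
From mathcomp Require Import measurable_realfun ring lra.

Set Implicit Arguments.
Unset Strict Implicit.
Unset Printing Implicit Defensive.

Import Order.TTheory GRing.Theory Num.Theory.
Import numFieldNormedType.Exports.

Local Open Scope classical_set_scope.
Local Open Scope ring_scope.

(** Write [l = 2 * exp 3 / 9], and let [chi] be the square root of a chi-square
variable. For [t >= 0] the functions [(|x| - t)_+ ^ 3], together with [1] and
[x ^ 2], generate the class under positive combinations, so [Q u] should be the
infimum over [t] of [E (chi - t)_+ ^ 3 / (u - t) ^ 3]. Near a large [u] the
variable [u * (chi - u)], given that it is nonnegative, is almost standard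
exponential, so with [t = u - s / u] this quotient is about
[6 * exp s / s ^ 3] times the tail probability. The minimum over [s] is at
[s = 3] and equals [6 * exp 3 / 27 = l].

The upper bound [Q_le] uses the single competitor [t = u - 3 / u].

The lower bound [Q_ge] has to hold for all functions [f] of the class at once.
It avoids writing [f] as a mixture of the generators. A mixture of the cubes
[(x - t)_+ ^ 3] is the third power of an [L^3] norm that is convex in [x], so
its cube root is convex; [cubic_comparison] proves this as the differential
inequality [2 * f' ^ 2 <= 3 * f * f''], comparing [f] with the cubic that has
the same first two derivatives. The resulting tangent inequality for the cube
root of [f] at [u] is made linear in [f] by the elementary inequality
[q ^ 3 >= 3 * q * c ^ 2 - 2 * c ^ 3], with [c] proportional to
[(u * (chi - u) + s)_+]. The summand [x ^ 2] satisfies the same inequality up to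
a factor that tends to [1] ([upconv_minorant]). Taking expectations bounds
[E f (chi) / f u] from below, uniformly in [f], by
[J2 ^ 3 / J3 ^ 2] with [Jk] the [k]-th moment of [(u * (chi - u) + s)_+].
The derivative of [f] at [u] enters with the sign of [J3 - s * J2]. In the limit
this is a positive multiple of [3 - s], which is why [s] is taken slightly
below [3]. The bound then tends to [2 * exp s / 9] times the tail probability.

The moments come from Laplace's method ([laplace_tail]): the chi-square density
at [u ^ 2 + z], divided by its value at [u ^ 2], tends to [exp (- z / 2)], while
[u * (sqrt (u ^ 2 + z) - u)] tends to [z / 2]; dominated convergence applies
uniformly for large [u]. *)

(** * Tangent inequality for cube roots *)

Lemma mean_value (R : realType) (f df : R -> R) (a b : R) : a < b ->
  (forall x, a <= x <= b -> is_derive x 1 f (df x)) ->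
  exists c, [/\ a < c, c < b & f b - f a = df c * (b - a)].
Proof.
move=> ab fdf.
have cf : {within `[a, b], continuous f}.
  apply: derivable_within_continuous => x; rewrite in_itv/= => /fdf fx.
  exact: ex_derive.
have [|c] := @MVT _ f df a b ab _ cf.
  by move=> x; rewrite in_itv/= => /andP[ax xb]; apply: fdf; rewrite !ltW.
by rewrite in_itv/= => /andP[ac cb]; exists c.
Qed.

Lemma derive_ge0_nondecreasing (R : realType) (f df : R -> R) (a b : R) :
  a <= b -> (forall x, a <= x <= b -> is_derive x 1 f (df x)) ->
  (forall x, a <= x <= b -> 0 <= df x) -> f a <= f b.
Proof.
rewrite le_eqVlt => /predU1P[-> //|ab] fdf df0.
have [c [ac cb e]] := mean_value ab fdf.
by rewrite -subr_ge0 e mulr_ge0 ?subr_ge0 ?df0 ?ltW//= ?ltW.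
Qed.

Definition convex_on (R : realType) (a b : R) (f : R -> R) :=
  forall x y t, a <= x <= b -> a <= y <= b -> 0 <= t <= 1 ->
    f (t * x + (1 - t) * y) <= t * f x + (1 - t) * f y.

Lemma convex_on_chord (R : realType) (a b : R) (f : R -> R) (x y z : R) :
  convex_on a b f -> a <= x -> x < y -> y < z -> z <= b ->
  (z - x) * f y <= (z - y) * f x + (y - x) * f z.
Proof.
move=> cf ax xy yz zb.
have zx : 0 < z - x by lra.
have := cf x z ((z - y) / (z - x)).
have -> : (z - y) / (z - x) * x + (1 - (z - y) / (z - x)) * z = y.
  by field; lra.
have t01 : 0 <= (z - y) / (z - x) <= 1.
  by rewrite divr_ge0 ?ler_pdivrMr//; lra.
move=> /(_ _ _ t01) h.
have {}h : f y <= (z - y) / (z - x) * f x + (1 - (z - y) / (z - x)) * f z.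
  by apply: h; lra.
rewrite -(ler_pM2l zx) in h; apply: (le_trans h).
by rewrite le_eqVlt; apply/orP; left; apply/eqP; field; lra.
Qed.

(** A dip of [p] below zero would make [dp] negative somewhere before it,
positive somewhere after it, and zero at [b], which convexity forbids. *)
Lemma convex_derive_ge0 (R : realType) (a b : R) (p dp : R -> R) :
  (forall x, a <= x <= b -> is_derive x 1 p (dp x)) -> convex_on a b dp ->
  0 <= p a -> p b = 0 -> dp b = 0 -> forall x, a <= x <= b -> 0 <= p x.
Proof.
move=> pdp cdp pa pb dpb x /andP[ax xb].
rewrite leNgt; apply/negP => px.
have {}ax : a < x by rewrite lt_neqAle ax andbT; apply/eqP => e; subst x; lra.
have {}xb : x < b by rewrite lt_neqAle xb andbT; apply/eqP => e; subst x; lra.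
have [|y [ay yx e1]] := @mean_value _ p dp _ _ ax.
  by move=> z hz; apply: pdp; lra.
have [|z [xz zb e2]] := @mean_value _ p dp _ _ xb.
  by move=> w hw; apply: pdp; lra.
have dy : dp y < 0.
  by rewrite -(pmulr_llt0 _ (_ : 0 < x - a)) -?e1; lra.
have dz : 0 < dp z.
  by rewrite -(pmulr_lgt0 _ (_ : 0 < b - x)) -?e2; lra.
have := convex_on_chord cdp (ltW ay) (lt_trans yx xz) zb (lexx b).
rewrite dpb mulr0 addr0 => h.
have : 0 < (b - y) * dp z by apply: mulr_gt0; lra.
have : (b - z) * dp y < 0 by rewrite pmulr_rlt0; lra.
lra.
Qed.

Lemma convex_increasing_ge0 (R : realType) (g g1 g2 : R -> R) :
  (forall y : R, is_derive y 1 g (g1 y)) ->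
  (forall y : R, is_derive y 1 g1 (g2 y)) ->
  (forall y : R, 0 <= y -> 0 <= g2 y) -> g1 0 = 0 -> 0 <= g 0 ->
  (forall y : R, 0 <= y -> 0 <= g1 y) /\ (forall y : R, 0 <= y -> 0 <= g y).
Proof.
move=> dg dg1 g2_ge0 g10 g0.
have g1_ge0 (y : R) : 0 <= y -> 0 <= g1 y.
  move=> y0; rewrite -g10; apply: (derive_ge0_nondecreasing (df := g2)) => //.
  by move=> z /andP[z0 _]; exact: g2_ge0.
split=> // y y0; apply: (le_trans g0).
apply: (derive_ge0_nondecreasing (df := g1)) => //.
by move=> z /andP[z0 _]; exact: g1_ge0.
Qed.

(** This says that the cube root of [g] is convex. With [g' x] and [g'' x]
given, [g x] is smallest when [g''] is zero up to some [t] and linear from there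
on, that is for a truncated cubic [k * (y - t)_+ ^ 3], which gives equality. The
cubic [h] with these two derivatives at [x] has [t = x - 2 * g' x / g'' x], and
[g - h] is nondecreasing between [t] and [x] by [convex_derive_ge0]. *)
Lemma cubic_comparison (R : realType) (g g1 g2 : R -> R) (x : R) :
  (forall y : R, is_derive y 1 g (g1 y)) ->
  (forall y : R, is_derive y 1 g1 (g2 y)) ->
  convex_on 0 x g2 -> (forall y : R, 0 <= y -> 0 <= g2 y) ->
  g2 0 = 0 -> g1 0 = 0 -> 0 <= g 0 -> 0 <= x ->
  2 * g1 x ^+ 2 <= 3 * g x * g2 x.
Proof.
move=> dg dg1 cg g2_ge0 g20 g10 g0.
rewrite le_eqVlt => /predU1P[<-|x0]; first by rewrite g20 g10; lra.
have g2le (y : R) : 0 <= y <= x -> x * g2 y <= y * g2 x.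
  move=> /andP[]; rewrite le_eqVlt => /predU1P[<-|y0].
    by rewrite g20; lra.
  rewrite le_eqVlt => /predU1P[->|yx]; first by [].
  by have := convex_on_chord cg (lexx _) y0 yx (lexx _); rewrite g20; lra.
have [g1_ge0 g_ge0] := convex_increasing_ge0 dg dg1 g2_ge0 g10 g0.
have g1le : 2 * g1 x <= x * g2 x.
  pose p y := g2 x / x * (y ^+ 2 / 2) - g1 y.
  have : p 0 <= p x.
    apply: (derive_ge0_nondecreasing (df := fun y => g2 x / x * y - g2 y)).
    - exact: ltW.
    - move=> y _; rewrite /p; apply: is_derive_eq.
      rewrite /GRing.scale/=. field; lra.
    - move=> y /g2le h; rewrite -(pmulr_rge0 _ x0).
      rewrite (_ : _ * _ = y * g2 x - x * g2 y); first by lra.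
      by field; lra.
  rewrite /p g10 expr0n/= mul0r mulr0 subr0 => h.
  have : g2 x / x * (x ^+ 2 / 2) = x * g2 x / 2 by field; lra.
  lra.
have := g1_ge0 _ (ltW x0); rewrite le_eqVlt => /predU1P[<-|A0].
  by rewrite expr0n/= mulr0 !mulr_ge0 ?g2_ge0 ?g_ge0 ?ltW.
have B0 : 0 < g2 x by rewrite -(pmulr_rgt0 _ x0); lra.
set A := g1 x in A0 g1le *; set B := g2 x in B0 g1le *.
pose w := 2 * A / B; have w0 : 0 < w by rewrite divr_gt0; lra.
have AE : A = B * w / 2 by rewrite /w; field; lra.
pose t := x - w.
have t0 : 0 <= t.
  rewrite /t subr_ge0 /w ler_pdivrMr//; lra.
pose h1 y := B / w * ((y - t) ^+ 2 / 2).
have dh1 (y : R) : is_derive y 1 h1 (B / w * (y - t)).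
  rewrite /h1; apply: is_derive_eq.
  rewrite /GRing.scale/=; field; lra.
have xt : x - t = w by rewrite /t; lra.
have p1_ge0 y : t <= y <= x -> 0 <= g1 y - h1 y.
  apply: (convex_derive_ge0 (p := fun y => g1 y - h1 y)
                            (dp := fun y => g2 y - B / w * (y - t))).
  - move=> y1 z1 s hy hz hs.
    by have := cg y1 z1 s; move: (B / w) => k; nra.
  - by rewrite /h1 subrr expr0n/= mul0r mulr0 subr0 g1_ge0.
  - by rewrite /h1 xt -/A AE; field; lra.
  - by rewrite xt -/B; field; lra.
pose h y := B / w * ((y - t) ^+ 3 / 6).
have dh (y : R) : is_derive y 1 h (h1 y).
  rewrite /h; apply: is_derive_eq.
  rewrite /GRing.scale/= /h1; field; lra.
have : g t - h t <= g x - h x.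
  apply: (derive_ge0_nondecreasing (df := fun y => g1 y - h1 y)) => //.
  - by rewrite /t; lra.
rewrite /h subrr expr0n/= mul0r mulr0 subr0 xt => ht.
have {}ht : B * w ^+ 2 / 6 <= g x.
  have -> : B * w ^+ 2 / 6 = B / w * (w ^+ 3 / 6) by field; lra.
  by have := g_ge0 _ t0; lra.
rewrite AE (_ : 2 * _ = 3 * (B * w ^+ 2 / 6) * B); last by field.
by rewrite ler_pM2r// ler_pM2l.
Qed.
Lemma tangent_le (R : realType) (q dq ddq : R -> R) (x u : R) :
  (forall y : R, 0 <= y -> is_derive y 1 q (dq y)) ->
  (forall y : R, 0 <= y -> is_derive y 1 dq (ddq y)) ->
  (forall y : R, 0 <= y -> 0 <= ddq y) -> 0 <= x -> 0 <= u ->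
  q u + dq u * (x - u) <= q x.
Proof.
move=> dq_ ddq_ ddq0 x0 u0.
have dq_le y z : 0 <= y -> y <= z -> dq y <= dq z.
  move=> y0 yz; apply: (derive_ge0_nondecreasing (df := ddq)) => // w hw;
    [apply: ddq_|apply: ddq0]; lra.
have [ux|xu|->] := ltgtP u x; last by lra.
- have [|c [uc cx e]] := @mean_value _ q dq _ _ ux.
    by move=> z hz; apply: dq_; lra.
  by have := dq_le _ _ u0 (ltW uc); nra.
- have [|c [xc cu e]] := @mean_value _ q dq _ _ xu.
    by move=> z hz; apply: dq_; lra.
  by have := dq_le _ _ (le_trans x0 (ltW xc)) (ltW cu); nra.
Qed.

(** The cube root [q] of [g] is convex, hence above its tangent at [u]. Cubing
that through [q x ^ 3 >= 3 * q x * c ^ 2 - 2 * c ^ 3] with [c = b * q u] makes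
it linear in [g], at the cost of the free parameter [b]. *)
Lemma cube_root_tangent_pos (R : realType) (g g1 g2 : R -> R) (x u b : R) :
  (forall y : R, is_derive y 1 g (g1 y)) ->
  (forall y : R, is_derive y 1 g1 (g2 y)) ->
  (forall y : R, 0 <= y -> 2 * g1 y ^+ 2 <= 3 * g y * g2 y) ->
  (forall y : R, 0 <= y -> 0 < g y) -> 0 <= x -> 0 <= u -> 0 <= b ->
  b ^+ 2 * (3 * g u + (x - u) * g1 u) - 2 * b ^+ 3 * g u <= g x.
Proof.
move=> dg dg1 gg g0 x0 u0 b0.
pose q y := expR (ln (g y) / 3).
pose dq y := q y * (g1 y / (3 * g y)).
pose ddq y := q y * (3 * g y * g2 y - 2 * g1 y ^+ 2) / (9 * g y ^+ 2).
have q0 y : 0 < q y by exact: expR_gt0.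
have q3 y : 0 <= y -> q y ^+ 3 = g y.
  move=> y0; rewrite /q -expRM_natl (_ : 3%:R * _ = ln (g y)); last by field.
  by rewrite lnK// posrE g0.
have dq_ y : 0 <= y -> is_derive (y : R) 1 q (dq y).
  move=> y0; have gy := g0 _ y0.
  have := is_derive1_comp (is_derive1_ln gy) (dg y).
  move=> dl.
  have : is_derive y 1 (fun z => ln (g z) / 3) (g1 y / (3 * g y)).
    apply: is_derive_eq; rewrite /GRing.scale/=; field; lra.
  exact: (is_derive1_comp (is_derive_expR _)).
have ddq_ y : 0 <= y -> is_derive (y : R) 1 dq (ddq y).
  move=> y0; have gy := g0 _ y0; have dqy := dq_ _ y0.
  have dV : is_derive y 1 (fun z => (3 * g z)^-1)
      (- (3 * g y) ^- 2 * (3 * g1 y)).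
    apply: (@is_deriveV _ (fun z => 3 * g z)); first by lra.
  rewrite /dq; apply: is_derive_eq.
  rewrite /GRing.scale/= /dq /ddq; field; lra.
have ddq0 y : 0 <= y -> 0 <= ddq y.
  move=> y0; have := gg _ y0; have := q0 y; have := sqr_ge0 (g y) => sg qy ggy.
  apply: divr_ge0; last by lra.
  by apply: mulr_ge0; lra.
have h := tangent_le dq_ ddq_ ddq0 x0 u0.
have gu := g0 _ u0.
have g1E : g1 u = 3 * q u ^+ 2 * dq u.
  by rewrite /dq -[in RHS](q3 _ u0); field; have := q0 u; lra.
rewrite g1E -!q3//.
have := q0 u; have := q0 x; move: (q u) (q x) (dq u) h => c z e h z0 c0.
have h1 : 3 * z * (b * c) ^+ 2 - 2 * (b * c) ^+ 3 <= z ^+ 3.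
  have : 0 <= (z - b * c) ^+ 2 * (z + 2 * (b * c)).
    by apply: mulr_ge0; [exact: sqr_ge0|have := mulr_ge0 b0 (ltW c0); lra].
  by lra.
apply: le_trans h1.
have : (b * c) ^+ 2 * (c + e * (x - u)) <= (b * c) ^+ 2 * z.
  by rewrite ler_wpM2l ?sqr_ge0.
by lra.
Qed.

Lemma cube_root_tangent (R : realType) (g g1 g2 : R -> R) (x u b : R) :
  (forall y : R, is_derive y 1 g (g1 y)) ->
  (forall y : R, is_derive y 1 g1 (g2 y)) ->
  (forall a, convex_on 0 a g2) -> (forall y : R, 0 <= y -> 0 <= g2 y) ->
  g2 0 = 0 -> g1 0 = 0 -> 0 <= g 0 -> 0 <= x -> 0 <= u -> 0 <= b ->
  b ^+ 2 * (3 * g u + (x - u) * g1 u) - 2 * b ^+ 3 * g u <= g x.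
Proof.
move=> dg dg1 cg g2_ge0 g20 g10 g0 x0 u0 b0.
have [g1_ge0 g_ge0] := convex_increasing_ge0 dg dg1 g2_ge0 g10 g0.
(* Adding a positive constant keeps [g] in the class and makes its cube root
   differentiable. *)
have key e : 0 < e ->
    b ^+ 2 * (3 * (g u + e) + (x - u) * g1 u) - 2 * b ^+ 3 * (g u + e)
    <= g x + e.
  move=> e0; apply: (@cube_root_tangent_pos _ (fun y => g y + e) g1 g2) => //.
  - by move=> y; apply: is_derive_eq; rewrite addr0.
  - move=> y y0; have := cubic_comparison dg dg1 (cg y) g2_ge0 g20 g10 g0 y0.
    by have := mulr_ge0 (ltW e0) (g2_ge0 _ y0); lra.
  - by move=> y /g_ge0; lra.
rewrite leNgt; apply/negP => lt_g.
set d := b ^+ 2 * (3 * g u + (x - u) * g1 u) - 2 * b ^+ 3 * g u - g x.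
have d0 : 0 < d by rewrite subr_gt0.
pose c := 1 + 2 * b ^+ 3.
have c0 : 0 < c by rewrite /c; have := exprn_ge0 3 b0; lra.
have := key (d / (2 * c)).
rewrite divr_gt0 ?mulr_gt0// => /(_ isT).
have : 2 * c * (d / (2 * c)) = d by field; lra.
move: (d / (2 * c)) => e e1.
have e0 : 0 < e by rewrite -(pmulr_rgt0 _ (_ : 0 < 2 * c)) ?e1//; lra.
have := mulr_ge0 (sqr_ge0 b) (ltW e0).
by rewrite /d /c in e1 d0 *; lra.
Qed.

(** * The class of test functions *)

Lemma is_derive_val (R : realType) (f : R -> R) (x d : R) :
  is_derive x 1 f d -> 'D_1 f x = d.
Proof. by move=> df; rewrite derive_val. Qed.

Lemma is_derive1_fun (R : realType) (f f1 : R -> R) :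
  (forall x : R, is_derive x 1 f (f1 x)) -> f^`()%classic = f1.
Proof.
by move=> df; apply/funext => x; rewrite derive1E (is_derive_val (df x)).
Qed.

Lemma is_derive_reflect (R : realType) (f f1 : R -> R) :
  (forall x : R, is_derive x 1 f (f1 x)) ->
  forall x : R, is_derive x 1 (fun y => f (- y)) (- f1 (- x)).
Proof.
move=> df x; have dN : is_derive (x : R) 1 (-%R : R -> R) (-1).
  by apply: is_derive_eq.
by have := is_derive1_comp (df (- x)) dN; rewrite mulrN1.
Qed.

Lemma derive_even (R : realType) (f f1 : R -> R) :
  (forall x : R, is_derive x 1 f (f1 x)) -> (forall x, f (- x) = f x) ->
  forall x, f1 (- x) = - f1 x.
Proof.
move=> df fE x; have := is_derive_reflect df x.
rewrite (_ : (fun y => f (- y)) = f); last exact/funext.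
by move=> /is_derive_val; rewrite (is_derive_val (df x)) => ->; rewrite opprK.
Qed.

Lemma derive_odd (R : realType) (f f1 : R -> R) :
  (forall x : R, is_derive x 1 f (f1 x)) -> (forall x, f (- x) = - f x) ->
  forall x, f1 (- x) = f1 x.
Proof.
move=> df fE x; have := is_derive_reflect df x.
rewrite (_ : (fun y => f (- y)) = - f); last by apply/funext => y; exact: fE.
move=> /is_derive_val; rewrite deriveN; last first.
  by have dfx := df x; exact: ex_derive.
by rewrite (is_derive_val (df x)) => /oppr_inj.
Qed.

Lemma convex_functionP (R : realType) (f : R -> R) :
  convex_function [set: R^o] f <->
  forall x y t, 0 <= t <= 1 ->
    f (t * x + (1 - t) * y) <= t * f x + (1 - t) * f y.
Proof.
split=> [cf x y t /andP[t0 t1]|cf t x y _ _].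
  by have := cf (Itv01 t0 t1) x y; rewrite !inE; exact.
by apply: (cf x y t%:num); rewrite ge0 le1.
Qed.

Lemma smoothstep_le1 (R : realType) (b : R) : 0 <= b ->
  3 * b ^+ 2 - 2 * b ^+ 3 <= 1.
Proof.
move=> b0; rewrite -subr_ge0.
rewrite (_ : _ - _ = (1 - b) ^+ 2 * (1 + 2 * b)); last by ring.
by apply: mulr_ge0; [exact: sqr_ge0|lra].
Qed.

Section upconv.
Variables (R : realType) (f f1 f2 : R -> R).
Hypothesis f_even : forall x, f (- x) = f x.
Hypothesis df : forall x : R, is_derive x 1 f (f1 x).
Hypothesis df1 : forall x : R, is_derive x 1 f1 (f2 x).
Hypothesis cf2 : forall x y t, 0 <= t <= 1 ->
  f2 (t * x + (1 - t) * y) <= t * f2 x + (1 - t) * f2 y.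
Hypotheses (f0 : 0 <= f 0) (f20 : 0 <= f2 0).

Lemma upconv_derive0 : f1 0 = 0.
Proof.
by have := derive_even df f_even 0; rewrite oppr0; lra.
Qed.

Lemma upconv_derive2_min (x : R) : f2 0 <= f2 x.
Proof.
have f2E := derive_odd df1 (derive_even df f_even).
(* [0] is the midpoint of [x] and [- x]. *)
have := @cf2 x (- x) 2^-1.
rewrite f2E (_ : 2^-1 * x + _ = 0); last by field.
move=> h; have : f2 0 <= 2^-1 * f2 x + (1 - 2^-1) * f2 x by apply: h; lra.
by lra.
Qed.

Lemma upconv_ge0 (x : R) : 0 <= x -> 0 <= f x.
Proof.
have f2_ge0 (y : R) : 0 <= y -> 0 <= f2 y.
  by move=> _; exact: le_trans f20 (upconv_derive2_min y).
have [_] := convex_increasing_ge0 df df1 f2_ge0 upconv_derive0 f0.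
exact.
Qed.

Lemma upconv_measurable : measurable_fun [set: R] f.
Proof.
apply: continuous_measurable_fun => x.
apply: differentiable_continuous; apply/derivable1_diffP.
by have dfx := df x; exact: ex_derive.
Qed.

(** Splitting off the quadratic part [c * x ^ 2], the remainder obeys the
tangent inequality for cube roots. The quadratic part obeys it too, since
[3 * b ^ 2 - 2 * b ^ 3 <= 1], but only where [x] is almost as large as [u],
and up to the factor [(1 - s / u ^ 2) ^ 2]. *)
Lemma upconv_minorant u s : 0 < u -> 0 <= s <= u ^+ 2 ->
  exists2 A, 0 <= A &
    forall x b, 0 <= x -> 0 <= b -> (0 < b -> u - s / u <= x) ->
    (1 - s / u ^+ 2) ^+ 2 *
      (b ^+ 2 * (3 * f u + (x - u) * A) - 2 * b ^+ 3 * f u) <= f x.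
Proof.
move=> u0 /andP[s0 su].
pose c := f2 0 / 2.
have c0 : 0 <= c by rewrite divr_ge0.
pose g x := f x - c * x ^+ 2.
pose g1 x := f1 x - 2 * c * x.
pose g2 x := f2 x - 2 * c.
have dg (x : R) : is_derive x 1 g (g1 x).
  have := df x => dx.
  by rewrite /g; apply: is_derive_eq; rewrite /g1 /GRing.scale/=; ring.
have dg1 (x : R) : is_derive x 1 g1 (g2 x).
  have := df1 x => dx.
  by rewrite /g1; apply: is_derive_eq; rewrite /g2 /GRing.scale/=; ring.
have cg2 a : convex_on 0 a g2.
  by move=> x y t _ _ ht; have := cf2 x y ht; rewrite /g2; lra.
have g2_ge0 (x : R) : 0 <= x -> 0 <= g2 x.
  by move=> _; have := upconv_derive2_min x; rewrite /g2 /c; lra.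
have g20 : g2 0 = 0 by rewrite /g2 /c; lra.
have g10 : g1 0 = 0 by rewrite /g1 upconv_derive0; lra.
have g0 : 0 <= g 0 by rewrite /g expr0n/= mulr0 subr0.
have [g1_ge0 g_ge0] := convex_increasing_ge0 dg dg1 g2_ge0 g10 g0.
exists (g1 u) => [|x b x0 b0 bx]; first by rewrite g1_ge0 ?ltW.
have gt := cube_root_tangent dg dg1 cg2 g2_ge0 g20 g10 g0 x0 (ltW u0) b0.
set v := 1 - s / u ^+ 2.
have u20 : 0 < u ^+ 2 by exact: exprn_gt0.
have v0 : 0 <= v by rewrite /v subr_ge0 ler_pdivrMr ?mul1r.
have v1 : v <= 1 by have := divr_ge0 s0 (ltW u20); rewrite /v; lra.
have v2 : v ^+ 2 <= 1 by rewrite expr_le1.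
have gx :
    v ^+ 2 * (b ^+ 2 * (3 * g u + (x - u) * g1 u) - 2 * b ^+ 3 * g u) <= g x.
  apply: (@le_trans _ _ (v ^+ 2 * g x)); first by rewrite ler_wpM2l ?sqr_ge0.
  by rewrite ler_piMl ?g_ge0.
have qx : v ^+ 2 * u ^+ 2 * (3 * b ^+ 2 - 2 * b ^+ 3) <= x ^+ 2.
  move: b0 bx; rewrite le_eqVlt => /predU1P[<- _|b0 /(_ b0) bx].
    by rewrite !expr0n/= !mulr0 subrr mulr0 sqr_ge0.
  have {}bx : u * v <= x.
    by rewrite (_ : u * v = u - s / u)// /v; field; lra.
  have uv0 : 0 <= u * v := mulr_ge0 (ltW u0) v0.
  apply: (@le_trans _ _ ((u * v) ^+ 2)); last by rewrite lerXn2r ?nnegrE.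
  rewrite [(u * v) ^+ 2]exprMn [u ^+ 2 * _]mulrC ler_piMr//.
    by rewrite mulr_ge0 ?sqr_ge0.
  exact/smoothstep_le1/ltW.
have -> : f u = g u + c * u ^+ 2 by rewrite /g subrK.
have -> : f x = g x + c * x ^+ 2 by rewrite /g subrK.
apply: le_trans (lerD gx (ler_wpM2l c0 qx)).
by rewrite le_eqVlt; apply/orP; left; apply/eqP; ring.
Qed.

End upconv.

Lemma C2upconv_derivatives (R : realType) (f : R -> R) : C2upconv f ->
  exists f1 f2 : R -> R,
  [/\ forall x, f (- x) = f x,
      forall x : R, is_derive x 1 f (f1 x),
      forall x : R, is_derive x 1 f1 (f2 x),
      forall x y t, 0 <= t <= 1 ->
        f2 (t * x + (1 - t) * y) <= t * f2 x + (1 - t) * f2 y &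
      0 <= f 0 /\ 0 <= f2 0].
Proof.
move=> [[fE df df1 /convex_functionP cf] f0 f20].
exists f^`()%classic, f^`(2)%classic; split.
- exact: fE.
- by move=> x; rewrite derive1E; exact: derivableP.
- move=> x; rewrite (derive1nS f 1) derive1n1 derive1E; exact: derivableP.
- exact: cf.
- by split.
Qed.

Lemma is_derive_pospart (R : realType) (n : nat) (x : R) :
  is_derive x 1 (fun y : R => Num.max y 0 ^+ n.+2)
    (n.+2%:R * Num.max x 0 ^+ n.+1).
Proof.
have [x0|x0|->] := ltgtP x 0.
- apply: (@near_eq_is_derive _ _ _ (cst 0)).
    near=> y; rewrite max_r ?expr0n//.
    by apply/ltW; near: y; exact: lt_nbhsl.
  by apply: is_derive_eq; rewrite expr0n/= mulr0.
- apply: (@near_eq_is_derive _ _ _ (fun y : R => y ^+ n.+2 : R)).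
    near=> y; rewrite max_l//.
    by apply/ltW; near: y; exact: lt_nbhsr.
  apply: DeriveDef; first exact: exprn_derivable.
  by rewrite exp_derive /GRing.scale/= mulr1.
- rewrite expr0n/= mulr0.
  have c0 : h^-1 * (Num.max h 0 ^+ n.+2) @[h --> (0:R)^'] --> (0:R).
    apply/cvgr0Pnorm_le => e e0; near=> h.
    have h1 : `|h| <= Num.min 1 e.
      near: h; apply: dnbhs0_le.
      by rewrite lt_min ltr01 e0.
    move: h1; rewrite le_min => /andP[h1 he].
    have h0 : 0 < `|h| by rewrite normr_gt0; near: h; exact: nbhs_dnbhs_neq.
    rewrite normrM normfV normrX ler_pdivrMl//.
    have mh : `|Num.max h 0| <= `|h|.
      by rewrite /Num.max; case: ifP => _ //; rewrite normr0.
    apply: (@le_trans _ _ (`|h| ^+ n.+2)); first by rewrite lerXn2r ?nnegrE.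
    rewrite exprS ler_pM2l//; apply: le_trans he.
    by rewrite exprS ler_piMr// exprn_ile1.
  have cq : h^-1 *: (((fun y : R => Num.max y 0 ^+ n.+2) \o shift 0) (h *: 1)
      - Num.max 0 0 ^+ n.+2) @[h --> (0:R)^'] --> (0:R).
    rewrite (_ : (fun h => _) = (fun h => h^-1 * (Num.max h 0 ^+ n.+2)))//.
    apply/funext => h /=.
    by rewrite /GRing.scale/= addr0 mulr1 maxxx expr0n/= subr0.
  apply: DeriveDef; first by apply/cvg_ex; exists 0; exact: cq.
  exact/cvg_lim.
Unshelve. all: by end_near. Qed.

(** For [t >= 0] the two summands have disjoint supports and add up to
[(|x| - t)_+ ^ 3]. Without the absolute value, the derivatives can be taken term
by term. *)
Lemma truncated_cubic_upconv (R : realType) (t : R) :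
  C2upconv (fun x => Num.max (x - t) 0 ^+ 3 + Num.max (- x - t) 0 ^+ 3).
Proof.
set f := (fun x => _).
pose f1 x := 3 * Num.max (x - t) 0 ^+ 2 - 3 * Num.max (- x - t) 0 ^+ 2.
pose f2 x := 6 * Num.max (x - t) 0 + 6 * Num.max (- x - t) 0.
have shiftD (x : R) n : is_derive x 1 (fun y => Num.max (y - t) 0 ^+ n.+2)
    (n.+2%:R * Num.max (x - t) 0 ^+ n.+1).
  have d1 : is_derive x 1 (fun y : R => y - t) 1.
    by apply: is_derive_eq; rewrite subr0.
  by have := @is_derive1_comp _ _ (fun y => y - t) _ _ _
    (is_derive_pospart n (x - t)) d1; rewrite mulr1.
have shiftN (x : R) n : is_derive x 1 (fun y => Num.max (- y - t) 0 ^+ n.+2)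
    (- (n.+2%:R * Num.max (- x - t) 0 ^+ n.+1)).
  have d1 : is_derive x 1 (fun y : R => - y - t) (- 1).
    by apply: is_derive_eq; rewrite subr0.
  by have := @is_derive1_comp _ _ (fun y => - y - t) _ _ _
    (is_derive_pospart n (- x - t)) d1; rewrite mulrN1.
have df (x : R) : is_derive x 1 f (f1 x).
  have d1 := shiftD x 1%N; have d2 := shiftN x 1%N.
  by rewrite /f; apply: is_derive_eq.
have df1 (x : R) : is_derive x 1 f1 (f2 x).
  have d1 := shiftD x 0%N; have d2 := shiftN x 0%N.
  rewrite /f1; apply: is_derive_eq; rewrite /f2 /GRing.scale/= !expr1; ring.
have f1E := is_derive1_fun df.
have f2E : f^`(2)%classic = f2.
  by rewrite (derive1nS f 1) derive1n1 f1E (is_derive1_fun df1).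
have max0 (y : R) : 0 <= Num.max y 0 by rewrite le_max lexx orbT.
split.
- split.
  + by move=> x; rewrite /f opprK addrC.
  + by move=> x; have dfx := df x; exact: ex_derive.
  + by move=> x; rewrite f1E; have dfx := df1 x; exact: ex_derive.
  + apply/convex_functionP => x y a /andP[a0 a1]; rewrite f2E /f2.
    have conv (y1 y2 : R) : Num.max (a * y1 + (1 - a) * y2) 0 <=
        a * Num.max y1 0 + (1 - a) * Num.max y2 0.
      rewrite ge_max; apply/andP; split; last first.
        by rewrite addr_ge0 ?mulr_ge0// subr_ge0.
      by rewrite lerD// ler_wpM2l ?subr_ge0// le_max lexx.
    have := conv (x - t) (y - t); have := conv (- x - t) (- y - t).
    rewrite (_ : a * (x - t) + _ = a * x + (1 - a) * y - t); last by ring.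
    rewrite (_ : a * (- x - t) + _ = - (a * x + (1 - a) * y) - t); last by ring.
    by lra.
- by rewrite /f addr_ge0// exprn_ge0.
- by rewrite f2E /f2 addr_ge0// mulr_ge0.
Qed.

(** * Changes of variables *)

Section density.
Local Open Scope ereal_scope.
Context d (T : measurableType d) (R : realType) (P : probability T R).
Variables (X : {RV P >-> R}) (p : R -> R).
Hypotheses (mp : measurable_fun [set: R] p) (p0 : forall x, (0 <= p x)%R).
Hypothesis Xp : forall A, measurable A ->
  distribution P X A = \int[lebesgue_measure]_(x in A) (p x)%:E.

Local Notation mu := (@lebesgue_measure R).

Lemma ge0_integral_density (phi : R -> R) : measurable_fun [set: R] phi ->
  (forall x, (0 <= phi x)%R) ->
  \int[P]_w (phi (X w))%:E = \int[mu]_x (phi x * p x)%:E.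
Proof.
move=> mphi phi0.
(* Lebesgue measure lives on a copy of [R] with its own display, to which the
   law of [X] has to be transported. *)
have mX : measurable_fun [set: T] (X : T -> measurableTypeR R).
  exact: measurable_funP X.
pose mX_mixin := isMeasurableFun.Build _ _ _ _ _ mX.
pose XR : {mfun T >-> measurableTypeR R} :=
  HB.pack (X : T -> measurableTypeR R) mX_mixin.
pose nu : {finite_measure set (measurableTypeR R) -> \bar R} :=
  distribution P XR.
have dom : nu `<< mu.
  apply/null_content_dominatesP => A mA muA0.
  transitivity (\int[mu]_(x in A) (p x)%:E); first exact: Xp.
  apply: null_set_integral => //.
  by apply/measurable_EFinP; exact: measurable_funS mp.
have mphiE : measurable_fun [set: R] (EFin \o phi) by exact/measurable_EFinP.
have mpE : measurable_fun [set: R] (EFin \o p) by exact/measurable_EFinP.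
transitivity (\int[nu]_x (phi x)%:E).
  by rewrite ge0_integral_distribution// => x; rewrite lee_fin.
have ig := Radon_Nikodym_SigmaFinite.f_integrable dom.
rewrite -(Radon_Nikodym_SigmaFinite.change_of_variables dom)//.
apply: ge0_ae_eq_integral => //.
- by apply: emeasurable_funM => //; exact: measurable_int ig.
- by apply/measurable_EFinP; exact: measurable_funM.
- move=> x _; rewrite mule_ge0 ?lee_fin//.
  exact: Radon_Nikodym_SigmaFinite.f_ge0.
- by move=> x _; rewrite lee_fin mulr_ge0.
have : ae_eq mu [set: R] (Radon_Nikodym_SigmaFinite.f nu mu) (EFin \o p).
  apply: integral_ae_eq => // A _ mA.
  rewrite -(Radon_Nikodym_SigmaFinite.f_integral dom)//.
  exact: Xp.
by apply: filterS => x h _; rewrite EFinM; congr (_ * _); exact: h.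
Qed.

End density.

Section translation.
Local Open Scope ereal_scope.
Context (R : realType).
Local Notation mu := (@lebesgue_measure R).

Lemma lebesgue_measure_translation (a : R) (A : set R) : measurable A ->
  pushforward mu ((fun x => x + a)%R : _ -> measurableTypeR R) A = mu A.
Proof.
move=> mA; apply/esym.
have ms : measurable_fun [set: R] ((fun x => x + a)%R : _ -> measurableTypeR R).
  exact: measurable_funD.
pose ms_mixin := isMeasurableFun.Build _ _ _ _ _ ms.
pose ms_pack : {mfun _ >-> _} :=
  HB.pack ((fun x => x + a)%R : R -> measurableTypeR R) ms_mixin.
apply: (@lebesgue_measure_unique R (pushforward mu ms_pack)) => //=.
move=> _ [[b c]] _ <-.
rewrite /pushforward/=.
rewrite (_ : _ @^-1` _ = `](b - a)%R, (c - a)%R]%classic); last first.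
  by apply/seteqP; split => x /=; rewrite !in_itv/= ltrBlDr lerBrDr.
rewrite !lebesgue_measure_itv/= !lte_fin ltrD2r; case: ifP => // _.
by rewrite -!EFinB; congr EFin; ring.
Qed.

Lemma ge0_integral_translation (a : R) (f : R -> \bar R) :
  measurable_fun [set: R] f -> (forall x, 0 <= f x) ->
  \int[mu]_x f x = \int[mu]_x f (x + a)%R.
Proof.
move=> mf f0.
pose shift_a := (fun x => x + a)%R : measurableTypeR R -> measurableTypeR R.
have ms : measurable_fun [set: measurableTypeR R] shift_a.
  exact: measurable_funD.
have h := @ge0_integral_pushforward _ _ (measurableTypeR R) (measurableTypeR R)
  R shift_a ms lebesgue_measure setT f measurableT mf (fun x _ => f0 x).
rewrite preimage_setT in h; rewrite -[RHS]h.
apply: eq_measure_integral => A mA _.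
exact/esym/lebesgue_measure_translation.
Qed.

End translation.

(** * Gamma integrals *)

Lemma exprn_le_expR (R : realType) (k : nat) (w : R) : 0 <= w ->
  w ^+ k <= k`!%:R * expR w.
Proof.
case: k => [|k] w0; first by rewrite expr0 mul1r -expR0 ler_expR.
have f0 : (0 : R) < (k.+1)`!%:R by rewrite ltr0n fact_gt0.
rewrite mulrC -ler_pdivrMr//; apply: le_trans (expR_ge1Dxn k w0).
by rewrite lerDr.
Qed.

Lemma exprn_expRN_cvg0 (R : realType) (k : nat) :
  (w ^+ k * expR (- w) : R) @[w --> +oo] --> (0 : R).
Proof.
pose c : R := (k.+1)`!%:R.
apply/cvgr0Pnorm_le => e e0; near=> w.
have w0 : 0 < w by [].
have ew : c <= e * w.
  by rewrite mulrC -ler_pdivrMr.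
rewrite ger0_norm ?mulr_ge0 ?exprn_ge0 ?expR_ge0 ?(ltW w0)//.
rewrite expRN ler_pdivrMr ?expR_gt0//.
rewrite -(ler_pM2l w0) -exprS; apply: (le_trans (exprn_le_expR k.+1 (ltW w0))).
by rewrite mulrA [w * e]mulrC ler_pM2r ?expR_gt0.
Unshelve. all: by end_near. Qed.

(** [- expR (- w) * gamma_poly k w] is a primitive of [w ^+ k * expR (- w)]. *)
Fixpoint gamma_poly (R : realType) (k : nat) (w : R) : R :=
  if k is l.+1 then w ^+ l.+1 + l.+1%:R * gamma_poly l w else 1.

Lemma gamma_poly0 (R : realType) (k : nat) : gamma_poly k (0 : R) = k`!%:R.
Proof.
by elim: k => //= k IH; rewrite IH expr0n/= add0r factS natrM.
Qed.

Lemma is_derive_gamma_poly (R : realType) (k : nat) (w : R) :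
  is_derive w 1 (@gamma_poly R k) (gamma_poly k w - w ^+ k).
Proof.
elim: k => [|k IH] /=.
  by rewrite subrr; exact: is_derive_cst.
have dX : is_derive (w : R) 1 (fun y : R => y ^+ k.+1 : R) (k.+1%:R * w ^+ k).
  apply: DeriveDef; first exact: exprn_derivable.
  by rewrite exp_derive /GRing.scale/= mulr1.
apply: is_derive_eq; rewrite /GRing.scale/=; ring.
Qed.

Lemma gamma_poly_expRN_cvg0 (R : realType) (k : nat) :
  (gamma_poly k w * expR (- w) : R) @[w --> +oo] --> (0 : R).
Proof.
elim: k => [|k IH] /=; first exact: (exprn_expRN_cvg0 0).
rewrite (_ : (fun w => _) = fun w => w ^+ k.+1 * expR (- w) +
    k.+1%:R * (gamma_poly k w * expR (- w))); last first.
  by apply/funext => w; ring.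
rewrite -[X in _ --> X]addr0; apply: cvgD; first exact: exprn_expRN_cvg0.
by rewrite -[X in _ --> X](mulr0 k.+1%:R); apply: cvgMl_tmp.
Qed.

Lemma half_shift_cvgy (R : realType) (s : R) : (z / 2 + s) @[z --> +oo] --> +oo.
Proof.
apply/cvgryPge => A; near=> z.
by rewrite -lerBlDr ler_pdivlMr.
Unshelve. all: by end_near. Qed.

Lemma integral_gamma_tail (R : realType) (k : nat) (s : R) :
  (\int[lebesgue_measure]_(z in `[(- (2 * s))%R, +oo[)
    ((z / 2 + s) ^+ k * expR (- (z / 2)))%:E = (2 * k`!%:R * expR s)%:E)%E.
Proof.
pose F (z : R) := - (2 * expR s) *
  (gamma_poly k (z / 2 + s) * expR (- (z / 2 + s))).
pose f (z : R) := (z / 2 + s) ^+ k * expR (- (z / 2)).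
have dw (z : R) : is_derive z 1 (fun y : R => y / 2 + s) 2^-1.
  by apply: is_derive_eq; rewrite /GRing.scale/=; field.
have dF (z : R) : is_derive z 1 F (f z).
  have dp := @is_derive1_comp _ _ (fun y : R => y / 2 + s) _ _ _
    (is_derive_gamma_poly k (z / 2 + s)) (dw z).
  have de : is_derive z 1 (fun y : R => expR (- (y / 2 + s)))
      (expR (- (z / 2 + s)) * - 2^-1).
    by apply: (@is_derive1_comp _ _ (fun y : R => - (y / 2 + s))).
  rewrite /F; apply: is_derive_eq; rewrite /GRing.scale/= /f.
  by rewrite opprD expRD [expR (- s)]expRN; field; rewrite gt_eqF ?expR_gt0.
have Fy : F z @[z --> +oo] --> (0 : R).
  rewrite /F -[X in _ --> X](mulr0 (- (2 * expR s))); apply: cvgMl_tmp.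
  exact: cvg_comp (@half_shift_cvgy R s) (@gamma_poly_expRN_cvg0 R k).
have cf : continuous f.
  move=> z; apply: cvgM; last first.
    apply: continuous_comp; last exact: continuous_expR.
    by apply: cvgN; apply: cvgMr_tmp.
  apply: (@continuous_comp _ _ _ (fun y : R => y / 2 + s : R)
    (fun w : R => w ^+ k : R)).
    by apply: cvgD; [exact: cvgMr_tmp|exact: cvg_cst].
  exact: exprn_continuous.
have cF : continuous F.
  move=> z; apply: differentiable_continuous; apply/derivable1_diffP.
  by have dFz := dF z; exact: ex_derive.
rewrite (@ge0_continuous_FTC2y _ f F _ 0) //.
- rewrite /F (_ : - (2 * s) / 2 + s = 0); last by field.
  rewrite gamma_poly0 oppr0 expR0 mulr1 sub0e -EFinN; congr EFin; ring.
- by move=> z hz; rewrite mulr_ge0 ?expR_ge0 ?exprn_ge0//; lra.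
- exact: continuous_subspaceT.
- exact/cvg_at_right_filter/cF.
- by move=> z _; rewrite (is_derive1_fun dF).
Qed.

Lemma integrable_expRN (R : realType) (c a : R) : 0 < c ->
  lebesgue_measure.-integrable `[a, +oo[ (fun z : R => (expR (- (c * z)))%:E).
Proof.
move=> c0; pose F (z : R) := - (expR (- (c * z)) / c).
have dF (z : R) : is_derive z 1 F (expR (- (c * z))).
  have de : is_derive z 1 (fun y : R => expR (- (c * y)))
      (expR (- (c * z)) * - c).
    apply: (@is_derive1_comp _ _ (fun y : R => - (c * y))).
    by apply: is_derive_eq; rewrite /GRing.scale/= mulr1.
  by rewrite /F; apply: is_derive_eq; rewrite /GRing.scale/=; field; lra.
have cE : continuous (fun z : R => expR (- (c * z))).
  move=> z; apply: continuous_comp; last exact: continuous_expR.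
  by apply: cvgN; apply: cvgMl_tmp.
have Fy : F z @[z --> +oo] --> (0 : R).
  rewrite /F -oppr0; apply: cvgN; rewrite -(mul0r c^-1); apply: cvgMr_tmp.
  have cy : (c * z) @[z --> +oo] --> +oo by exact: gt0_cvgMry.
  exact: cvg_comp cy (@cvgr_expR R).
have cF : continuous F.
  move=> z; apply: differentiable_continuous; apply/derivable1_diffP.
  by have dFz := dF z; exact: ex_derive.
apply/integrableP; split.
  by apply/measurable_EFinP/measurable_funTS; exact: continuous_measurable_fun.
under eq_integral do rewrite gee0_abs ?lee_fin ?expR_ge0//.
rewrite (@ge0_continuous_FTC2y _ (fun z : R => expR (- (c * z))) F _ 0)//.
- by rewrite -EFinB ltry.
- exact: continuous_subspaceT.
- exact/cvg_at_right_filter/cF.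
- by move=> z _; rewrite (is_derive1_fun dF).
Qed.

(** * Laplace's method for the tail *)

(** With [x = chi ^ 2] this is [u * (chi - u)], the variable that becomes
exponential. It is a function of the square because the chi-square variable is
the one with a given density. *)
Definition rescale (R : realType) (u x : R) : R := u * (Num.sqrt x - u).

Lemma measurable_rescale (R : realType) (u : R) :
  measurable_fun [set: R] (rescale u).
Proof.
apply: continuous_measurable_fun => x; apply: cvgMl_tmp; apply: cvgB.
  exact: sqrt_continuous.
exact: cvg_cst.
Qed.

Lemma rescale_le (R : realType) (u z : R) : 0 < u -> - (2 * u ^+ 2) <= z ->
  rescale u (z + u ^+ 2) <= z / 2.
Proof.
move=> u0 uz; rewrite /rescale -(mulVKf (lt0r_neq0 u0) (z / 2)).
rewrite ler_pM2l// lerBlDr; set b := _ + u.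
have b0 : 0 <= b.
  have -> : b = (z + 2 * u ^+ 2) / (2 * u) by rewrite /b; field; lra.
  by apply: divr_ge0; lra.
rewrite -(ger0_norm b0) -sqrtr_sqr ler_wsqrtr//.
have -> : b ^+ 2 = z + u ^+ 2 + (z / (2 * u)) ^+ 2 by rewrite /b; field; lra.
by rewrite lerDl sqr_ge0.
Qed.

Lemma div_sqr_cvgy (R : realType) (z : R) :
  (z / u ^+ 2 : R) @[u --> +oo] --> (0 : R).
Proof.
apply/cvgr0Pnorm_le => e e0; near=> u.
have u1 : 1 <= u by [].
have uz : `|z| / e <= u by [].
have u0 : 0 < u by lra.
rewrite normrM normfV (ger0_norm (sqr_ge0 u)) ler_pdivrMr ?exprn_gt0//.
apply: (@le_trans _ _ (e * u)).
  by rewrite mulrC -ler_pdivrMr.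
by rewrite ler_pM2l// expr2 ler_peMr// ltW.
Unshelve. all: by end_near. Qed.

Lemma rescale_cvg (R : realType) (z : R) :
  (rescale u (z + u ^+ 2) : R) @[u --> +oo] --> (z / 2 : R).
Proof.
have c1 : (Num.sqrt (1 + z / u ^+ 2) + 1 : R) @[u --> +oo] --> (2 : R).
  rewrite (_ : 2 = Num.sqrt (1 + 0) + 1); last by rewrite addr0 sqrtr1.
  apply: cvgD; last exact: cvg_cst.
  apply: (@cvg_comp _ _ _ (fun u : R => 1 + z / u ^+ 2) (@Num.sqrt R)).
    by apply: cvgD; [exact: cvg_cst|exact: div_sqr_cvgy].
  exact: sqrt_continuous.
have c2 : (z / (Num.sqrt (1 + z / u ^+ 2) + 1) : R) @[u --> +oo] -->
    (z / 2 : R).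
  by apply: cvgMl_tmp; apply: cvgV.
apply: cvg_trans c2; apply: near_eq_cvg; near=> u.
have u1 : 1 <= u by [].
have uz : `|z| <= u by [].
have u0 : 0 < u by lra.
have hz : 0 <= 1 + z / u ^+ 2.
  rewrite -lerBlDl sub0r ler_pdivlMr ?exprn_gt0// mulN1r.
  rewrite lerNl (le_trans (ler_norm _))// normrN (le_trans uz)//.
  by rewrite expr2 ler_peMr// ltW.
rewrite /rescale (_ : z + u ^+ 2 = u ^+ 2 * (1 + z / u ^+ 2)); last first.
  by field; lra.
rewrite sqrtrM ?sqr_ge0// sqrtr_sqr ger0_norm ?ltW//.
set q := Num.sqrt _.
have q0 : 0 <= q by exact: sqrtr_ge0.
have zE : z = u ^+ 2 * (q ^+ 2 - 1).
  by rewrite sqr_sqrtr//; field; lra.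
by rewrite [in LHS]zE; field; lra.
Unshelve. all: by end_near. Qed.

(** The logarithm of [1 + h] lies between [-1] and [h]. *)
Lemma powR1D_le (R : realType) (m h : R) : - 2^-1 <= h ->
  (1 + h) `^ m <= expR (`|m| * (1 + `|h|)).
Proof.
move=> h2; have h1 : 0 < 1 + h by lra.
rewrite /powR gt_eqF// ler_expR (le_trans (ler_norm _))// normrM.
rewrite ler_wpM2l// ler_norml; apply/andP; split.
  have l2 : - 1 <= ln (1 + h).
    rewrite -ler_expR lnK ?posrE//.
    rewrite expRN (@le_trans _ _ 2^-1)//; last by lra.
    rewrite lef_pV2 ?posrE ?expR_gt0//.
    by have := @expR_ge1Dx R 1; lra.
  by apply: le_trans l2; rewrite lerN2 lerDl.
have := @expR_ge1Dx R h; rewrite -{1}[1 + h]lnK ?posrE// ler_expR => /le_trans.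
by apply; rewrite (le_trans (ler_norm _))// lerDr.
Qed.

Section laplace.
Context (R : realType).
Variables (m c : R) (p : R -> R).
Hypotheses (c0 : 0 <= c) (mp : measurable_fun [set: R] p).
Hypothesis p_pos : forall x, 0 < x -> p x = c * (x `^ m * expR (- (x / 2))).
Hypothesis p_neg : forall x, x <= 0 -> p x = 0.

Local Notation mu := (@lebesgue_measure R).

Definition density_scale (u : R) : R :=
  c * ((u ^+ 2) `^ m * expR (- (u ^+ 2 / 2))).

Variables (psi : R -> R) (s C L : R).
Hypotheses (s0 : 0 <= s) (mpsi : measurable_fun [set: R] psi).
Hypothesis psi0 : forall y, 0 <= psi y.
Hypothesis psi_supp : forall y, y < - s -> psi y = 0.
Hypothesis psi_le : forall y, psi y <= C * expR (y / 4).
Hypothesis psi_cvg : forall z,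
  psi (rescale u (z + u ^+ 2)) @[u --> +oo] --> psi (z / 2).
Hypothesis psi_int :
  (\int[mu]_(z in `[(- (2 * s))%R, +oo[) (psi (z / 2) * expR (- (z / 2)))%:E =
    L%:E)%E.

(* From [u0] on, [4 * s <= u ^ 2] keeps [1 + z / u ^ 2 >= 1 / 2] on the support,
   and [4 * |m| <= u ^ 2] keeps the power factor below a multiple of
   [exp (|z| / 4)]. *)
Let u0 := 1 + 4 * s + 4 * `|m|.
(* The integrand at [x = u ^ 2 + z] divided by [density_scale u]. *)
Let F u z := psi (rescale u (z + u ^+ 2)) *
  ((1 + z / u ^+ 2) `^ m * expR (- (z / 2))).
Local Notation D := (`[- (2 * s), +oo[%classic : set R).

Let u0_bounds u : u0 <= u ->
  [/\ 1 <= u, 4 * s + 1 <= u ^+ 2 & 4 * `|m| <= u ^+ 2].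
Proof.
move=> uu0; have m0 := normr_ge0 m; have s_ge0 := s0.
have u1 : 1 <= u by rewrite /u0 in uu0; lra.
have : u <= u ^+ 2 by rewrite expr2 ler_peMr//; lra.
by rewrite /u0 in uu0 *; split=> //; lra.
Qed.

(** The exponents add up as [z / 8 + |z| / 4 - z / 2], where
[|z| <= z + 4 * s] on the support. *)
Let F_le u z : u0 <= u -> D z ->
  0 <= F u z <= C * expR (`|m| + s) * expR (- (8^-1 * z)).
Proof.
move=> /u0_bounds[u1 us um]; have s_ge0 := s0; rewrite /= in_itv/= andbT => zs.
have C0 : 0 <= C.
  have := le_trans (psi0 0) (psi_le 0); rewrite mul0r expR0 mulr1//.
have u20 : 0 < u ^+ 2 by apply: exprn_gt0; lra.
have hz : - 2^-1 <= z / u ^+ 2 by rewrite ler_pdivlMr//; lra.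
have pz := powR1D_le m hz.
apply/andP; split; first by rewrite /F !mulr_ge0 ?powR_ge0 ?expR_ge0.
have r_le : rescale u (z + u ^+ 2) <= z / 2 by apply: rescale_le; lra.
have p_le : psi (rescale u (z + u ^+ 2)) <= C * expR (z / 8).
  apply: (le_trans (psi_le _)); rewrite ler_wpM2l// ler_expR.
  by rewrite ler_pdivrMr//; lra.
rewrite /F; apply: (@le_trans _ _ (C * expR (z / 8) *
    (expR (`|m| * (1 + `|z / u ^+ 2|)) * expR (- (z / 2))))).
  by rewrite ler_pM ?mulr_ge0 ?powR_ge0 ?expR_ge0// ler_wpM2r ?expR_ge0.
rewrite -!mulrA ler_wpM2l// -!expRD ler_expR.
have nz : `|m| * `|z / u ^+ 2| <= `|z| / 4.
  rewrite normrM normfV (ger0_norm (ltW u20)) mulrCA ler_wpM2l//.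
  by rewrite ler_pdivrMr// ler_pdivlMl//; lra.
have zz : `|z| <= z + 4 * s by rewrite ler_norml; apply/andP; split; lra.
by rewrite mulrDr mulr1; lra.
Qed.

Let measurable_F u : measurable_fun D (fun z => (F u z)%:E).
Proof.
apply/measurable_EFinP; apply: measurable_funTS; apply: measurable_funM.
  apply: (measurableT_comp mpsi).
  apply: (measurableT_comp (measurable_rescale u)).
  exact: measurable_funD.
apply: measurable_funM.
  apply: (measurableT_comp (measurable_powR _)).
  by apply: measurable_funD => //; exact: measurable_funM.
apply: continuous_measurable_fun => z.
apply: continuous_comp; last exact: continuous_expR.
by apply: cvgN; apply: cvgMr_tmp.
Qed.

Let F_cvg z : F u z @[u --> +oo] --> psi (z / 2) * expR (- (z / 2)).
Proof.
apply: cvgM; first exact: psi_cvg.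
rewrite -[X in _ --> X]mul1r; apply: cvgM; last exact: cvg_cst.
have c1 : (1 + z / u ^+ 2 : R) @[u --> +oo] --> (1 : R).
  rewrite -[X in _ --> X]addr0; apply: cvgD; first exact: cvg_cst.
  exact: div_sqr_cvgy.
have cp : {for (1 : R), continuous (fun y => y `^ m)}.
  apply: differentiable_continuous; apply/derivable1_diffP.
  by apply: derivable_powR; rewrite in_itv/= andbT.
rewrite /prop_for /continuous_at powR1 in cp.
exact: cvg_comp c1 cp.
Qed.

Let maj_integrable :
  mu.-integrable D (fun z => (C * expR (`|m| + s) * expR (- (8^-1 * z)))%:E).
Proof.
rewrite [X in mu.-integrable _ X](_ : _ = fun z =>
    ((C * expR (`|m| + s))%:E * (expR (- (8^-1 * z)))%:E)%E); last first.
  by apply/funext => z; rewrite EFinM.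
by apply: integrableZl => //; exact: integrable_expRN.
Qed.

Let F_integrable u : u0 <= u -> mu.-integrable D (fun z => (F u z)%:E).
Proof.
move=> uu0; apply: le_integrable maj_integrable => //.
  exact: measurable_F.
move=> z Dz.
have /andP[F0 Fle] := F_le uu0 Dz.
by rewrite /= lee_fin (ger0_norm F0) (ger0_norm (le_trans F0 Fle)).
Qed.

(* The maximum makes the domination hold for every [u], as dominated convergence
   along a sequence requires. *)
Let I u := fine (\int[mu]_(z in D) (F (Num.max u u0) z)%:E).

Let I_cvg : I u @[u --> +oo] --> L.
Proof.
apply/cvg_pinftyP => v vy.
have wy : Num.max (v n) u0 @[n --> \oo] --> +oo.
  apply/cvgryPge => A; near=> n; rewrite le_max; apply/orP; left.
  by near: n; move/cvgryPge : vy; exact.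
have : (\int[mu]_(z in D) (F (Num.max (v n) u0) z)%:E)%E @[n --> \oo] --> L%:E.
  rewrite -psi_int.
  apply: (@dominated_cvg _ _ _ mu D _
    (fun n z => (F (Num.max (v n) u0) z)%:E) _
    (fun z => (C * expR (`|m| + s) * expR (- (8^-1 * z)))%:E)) => //.
  - by move=> n; exact: measurable_F.
  - move=> z _; apply: cvg_EFin; first exact: nearW.
    exact: cvg_comp _ _ wy (@F_cvg z).
  - move=> n z Dz.
    have uu : u0 <= Num.max (v n) u0 by rewrite le_max lexx orbT.
    have /andP[F0 Fle] := F_le uu Dz.
    by rewrite lee_fin ger0_norm.
exact: fine_cvg.
Unshelve. all: by end_near. Qed.

(** The density proportional to [x ^ m * exp (- x / 2)], seen at [x = u ^ 2 + z]
and divided by [density_scale u], tends to [exp (- z / 2)], while [rescale u x]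
tends to [z / 2]. *)
Lemma laplace_tail : exists2 J : R -> R, J u @[u --> +oo] --> L &
  \forall u \near +oo,
    (\int[mu]_x (psi (rescale u x) * p x)%:E = (density_scale u * J u)%:E)%E.
Proof.
exists I; first exact: I_cvg.
near=> u.
have uu0 : u0 <= u by [].
have [u1 us um] := u0_bounds uu0; have s_ge0 := s0.
have u20 : 0 < u ^+ 2 by lra.
rewrite (ge0_integral_translation (u ^+ 2)); last 2 first.
- apply/measurable_EFinP; apply: measurable_funM => //.
  by apply: (measurableT_comp mpsi); exact: measurable_rescale.
- move=> x; rewrite lee_fin mulr_ge0//.
  have [x0|x0] := leP x 0; first by rewrite p_neg.
  by rewrite p_pos// mulr_ge0 ?mulr_ge0 ?powR_ge0 ?expR_ge0.
have GE z : psi (rescale u (z + u ^+ 2)) * p (z + u ^+ 2) =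
    (if z \in D then density_scale u * F u z else 0).
  case: ifPn.
    rewrite inE/= in_itv/= andbT => zs.
    rewrite /F /density_scale p_pos; last by lra.
    have -> : z + u ^+ 2 = u ^+ 2 * (1 + z / u ^+ 2) by field; lra.
    have hz : 0 <= 1 + z / u ^+ 2.
      by rewrite -lerBlDl sub0r ler_pdivlMr// ; lra.
    rewrite (powRM _ (ltW u20) hz).
    have -> : - (u ^+ 2 * (1 + z / u ^+ 2) / 2) = - (u ^+ 2 / 2) + - (z / 2).
      by field; lra.
    by rewrite expRD; ring.
  rewrite notin_setE/= in_itv/= andbT => /negP; rewrite -ltNge => zs.
  have [zu|zu] := leP (z + u ^+ 2) 0; first by rewrite p_neg ?mulr0.
  rewrite psi_supp ?mul0r//.
  have : rescale u (z + u ^+ 2) <= z / 2 by apply: rescale_le; lra.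
  by lra.
under eq_integral do rewrite GE.
transitivity (\int[mu]_(z in D) (density_scale u * F u z)%:E)%E.
  rewrite [RHS]integral_mkcond; apply: eq_integral => z _.
  by rewrite patchE; case: ifP.
under eq_integral do rewrite EFinM.
rewrite integralZl//; last exact: F_integrable.
rewrite [RHS]EFinM /I (max_l uu0) fineK//.
exact: integrable_fin_num (F_integrable uu0).
Unshelve. all: by end_near. Qed.

End laplace.

(** * Tail probability and moments of the chi distribution *)

Definition indicator_ge0 (R : realType) (y : R) : R := (0 <= y)%R%:R.

Definition pospart_pow (R : realType) (s : R) (k : nat) (y : R) : R :=
  Num.max (y + s) 0 ^+ k.

Lemma measurable_indicator_ge0 (R : realType) :
  measurable_fun [set: R] (@indicator_ge0 R).
Proof.
rewrite (_ : @indicator_ge0 R = \1_(`[0, +oo[%classic : set R)).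
  by apply: measurable_indic; exact: measurable_itv.
by apply/funext => y; rewrite /indicator_ge0 indicE mem_setE in_itv/= andbT.
Qed.

Lemma pospart_pow_ge0 (R : realType) (s : R) k y : 0 <= pospart_pow s k y.
Proof. by rewrite exprn_ge0// le_max lexx orbT. Qed.

Lemma continuous_pospart_pow (R : realType) (s : R) k :
  continuous (pospart_pow s k).
Proof.
move=> y; rewrite /pospart_pow.
apply: (@continuous_comp _ _ _ (fun y : R => Num.max (y + s) 0 : R)
    (fun w : R => w ^+ k : R)); last exact: exprn_continuous.
apply: (@continuous_max R R (fun y : R => y + s : R) (cst 0)).
  by apply: cvgD; [exact: cvg_id|exact: cvg_cst].
exact: cvg_cst.
Qed.

Lemma measurable_pospart_pow (R : realType) (s : R) k :
  measurable_fun [set: R] (pospart_pow s k).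
Proof. by apply: continuous_measurable_fun; exact: continuous_pospart_pow. Qed.

Section chi_square_tail.
Context (R : realType) (r : nat).
Context d (T : measurableType d) (P : probability T R) (X : {RV P >-> R}).
Hypothesis hX : chi_square_distributed r X.

Let m : R := r%:R / 2 - 1.
Let c : R := (2 `^ (r%:R / 2) * Gamma (r%:R / 2))^-1.
Let p : R -> R := chi_square_pdf r.
Local Notation mu := (@lebesgue_measure R).

Let p_pos x : 0 < x -> p x = c * (x `^ m * expR (- (x / 2))).
Proof.
move=> x0; rewrite /p /chi_square_pdf patchE ifT; last first.
  by rewrite inE/= in_itv/= andbT.
by rewrite mulrC mulNr.
Qed.

Let p_neg x : x <= 0 -> p x = 0.
Proof.
move=> x0; rewrite /p /chi_square_pdf patchE ifF//.
apply/negbTE; rewrite notin_setE/= in_itv/= andbT.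
by apply/negP; rewrite -leNgt.
Qed.

Let c_ge0 : 0 <= c.
Proof.
rewrite /c invr_ge0 mulr_ge0 ?powR_ge0// /Gamma Rintegral_ge0// => t _.
by rewrite mulr_ge0 ?powR_ge0 ?expR_ge0.
Qed.

Let p_ge0 x : 0 <= p x.
Proof.
have [x0|x0] := leP x 0; first by rewrite p_neg.
by rewrite p_pos// mulr_ge0 ?mulr_ge0 ?powR_ge0 ?expR_ge0.
Qed.

Let mp : measurable_fun [set: R] p.
Proof.
rewrite (_ : p = (fun x => c * (x `^ m * expR (- (x / 2)))) \_ `]0, +oo[).
  apply/(measurable_restrictT _ _).1 => //.
  apply: measurable_funTS; apply: measurable_funM => //.
  apply: measurable_funM; first exact: measurable_powR.
  apply: continuous_measurable_fun => z.
  apply: continuous_comp; last exact: continuous_expR.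
  by apply: cvgN; apply: cvgMr_tmp.
apply/funext => x; rewrite patchE; case: ifPn.
  by rewrite inE/= in_itv/= andbT => /p_pos.
by rewrite notin_setE/= in_itv/= andbT => /negP; rewrite -leNgt => /p_neg.
Qed.

(** Division by a vanishing Gamma value would make the density identically zero,
whereas its total mass is one. *)
Let c_gt0 : 0 < c.
Proof.
rewrite lt_neqAle c_ge0 andbT; apply/eqP => c0.
have p0 x : p x = 0.
  have [x0|x0] := leP x 0; first by rewrite p_neg.
  by rewrite p_pos// -c0 mul0r.
have := hX measurableT; rewrite probability_setT -/p.
under eq_integral do rewrite p0.
by rewrite integral0 => /eqP; rewrite eqe oner_eq0.
Qed.

Definition chi_scale : R -> R := density_scale m c.

Lemma chi_scale_gt0 u : 0 < u -> 0 < chi_scale u.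
Proof.
move=> u0; rewrite /chi_scale /density_scale !mulr_gt0 ?expR_gt0//.
by rewrite powR_gt0 ?exprn_gt0.
Qed.

Let tail_moment (psi : R -> R) (s C L : R) : 0 <= s ->
  measurable_fun [set: R] psi -> (forall y, 0 <= psi y) ->
  (forall y, y < - s -> psi y = 0) -> (forall y, psi y <= C * expR (y / 4)) ->
  (forall z, psi (rescale u (z + u ^+ 2)) @[u --> +oo] --> psi (z / 2)) ->
  (\int[mu]_(z in `[(- (2 * s))%R, +oo[) (psi (z / 2) * expR (- (z / 2)))%:E =
    L%:E)%E ->
  exists2 J : R -> R, J u @[u --> +oo] --> L &
    \forall u \near +oo, (\int[P]_w (psi (rescale u (X w)))%:E =
      (chi_scale u * J u)%:E)%E.
Proof.
move=> s0 mpsi psi0 psi_supp psi_le psi_cvg psi_int.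
have [J JL hJ] := laplace_tail c_ge0 mp p_pos p_neg s0 mpsi psi0 psi_supp
  psi_le psi_cvg psi_int.
exists J => //; apply: filterS hJ => u <-.
rewrite -(ge0_integral_density mp p_ge0 hX)//.
by apply: (measurableT_comp mpsi); exact: measurable_rescale.
Qed.

Lemma tail_probability : exists2 J : R -> R, J u @[u --> +oo] --> (2 : R) &
  \forall u \near +oo,
    P [set w | u <= Num.sqrt (X w)] = (chi_scale u * J u)%:E.
Proof.
have [] := @tail_moment (@indicator_ge0 R) 0 1 2 (lexx 0)
  (@measurable_indicator_ge0 R).
- by move=> y; rewrite ler0n.
- by move=> y; rewrite oppr0 /indicator_ge0 ltNge => /negbTE ->.
- move=> y; rewrite mul1r /indicator_ge0; case: (leP 0 y) => y0.
    by rewrite -expR0 ler_expR divr_ge0.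
  exact: expR_ge0.
- move=> z; apply: (@cvg_trans _ (cst (indicator_ge0 (z / 2)) u @[u --> +oo])).
    apply: near_eq_cvg; near=> u.
    have u1 : 1 <= u by [].
    have u_gt0 : 0 < u by lra.
    have uE : u = Num.sqrt (u ^+ 2) by rewrite sqrtr_sqr ger0_norm ?ltW.
    have u20 : 0 < u ^+ 2 by rewrite exprn_gt0.
    rewrite /indicator_ge0/= /rescale (pmulr_rge0 _ u_gt0) subr_ge0.
    rewrite pmulr_lge0 ?invr_gt0// [X in X <= Num.sqrt _]uE.
    congr (nat_of_bool _)%:R.
    have [z0|z0] := leP 0 z; first by rewrite ler_wsqrtr// lerDr.
    by apply/esym/negbTE; rewrite -ltNge ltr_sqrt//; lra.
  exact: cvg_cst.
- rewrite -[RHS](_ : (2 * (0`!)%:R * expR 0)%:E = _); last first.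
    by rewrite expR0 !mulr1.
  rewrite -integral_gamma_tail; apply: eq_integral => z.
  rewrite inE/= in_itv/= andbT mulr0 oppr0 => z0.
  by rewrite expr0 /indicator_ge0 divr_ge0.
move=> J JL hJ; exists J => //; near=> u.
have u1 : 1 <= u by [].
transitivity (\int[P]_w (indicator_ge0 (rescale u (X w)))%:E)%E; last first.
  by near: u.
have mA : measurable [set w | u <= Num.sqrt (X w)].
  rewrite -[X in measurable X]setTI.
  have mf : measurable_fun [set: T] (fun w => Num.sqrt (X w)).
    apply: measurableT_comp => //; apply: continuous_measurable_fun.
    exact: sqrt_continuous.
  have := mf measurableT `[u, +oo[%classic (measurable_itv _).
  congr (measurable _); apply/seteqP.
  by split => w /=; rewrite in_itv/= andbT; tauto.
rewrite -(setIT [set w | _]) -integral_indic//; apply: eq_integral => w _.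
have u_gt0 : 0 < u by lra.
rewrite indicE /indicator_ge0 /rescale (pmulr_rge0 _ u_gt0) subr_ge0.
by rewrite mem_setE.
Unshelve. all: by end_near. Qed.

Lemma pospart_moment (s : R) (k : nat) : 0 <= s -> (0 < k)%N ->
  exists2 J : R -> R, J u @[u --> +oo] --> 2 * k`!%:R * expR s &
  \forall u \near +oo, (\int[P]_w (pospart_pow s k (rescale u (X w)))%:E =
    (chi_scale u * J u)%:E)%E.
Proof.
move=> s0 k0.
apply: (@tail_moment _ s (4 ^+ k * k`!%:R * expR (s / 4))) => //.
- exact: measurable_pospart_pow.
- exact: pospart_pow_ge0.
- by move=> y ys; rewrite /pospart_pow max_r ?expr0n ?gtn_eqF//; lra.
- move=> y; rewrite -mulrA -expRD -mulrDl [s + y]addrC /pospart_pow.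
  have [ys|ys] := leP 0 (y + s).
    have -> : (y + s) ^+ k = 4 ^+ k * ((y + s) / 4) ^+ k.
      by rewrite -exprMn; congr (_ ^+ _); field.
    rewrite -mulrA ler_wpM2l ?exprn_ge0//.
    by apply: exprn_le_expR; rewrite divr_ge0.
  by rewrite expr0n gtn_eqF// !mulr_ge0 ?expR_ge0 ?exprn_ge0.
- move=> z; apply: (cvg_comp _ _ (@rescale_cvg R z)).
  exact: continuous_pospart_pow.
- rewrite -integral_gamma_tail; apply: eq_integral => z.
  rewrite inE/= in_itv/= andbT => zs.
  by rewrite /pospart_pow max_l//; lra.
Qed.

End chi_square_tail.

(** * Bounds for [Q] *)

Lemma expectationE d (T : measurableType d) (R : realType) (P : probability T R)
  (Y : T -> R) : ('E_P[Y] = \int[P]_w (Y w)%:E)%E.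
Proof. by rewrite unlock. Qed.

Lemma ediv_EFin (R : realType) (a b : R) : b != 0 ->
  (a%:E / b%:E = (a / b)%:E)%E.
Proof. by move=> b0; rewrite inver (negbTE b0). Qed.

Lemma lee_ediv_EFin (R : realType) (a b : R) (x : \bar R) : 0 < b ->
  ((a * b)%:E <= x)%E -> (a%:E <= x / b%:E)%E.
Proof.
move=> b0 abx; have -> : a%:E = ((a * b)%:E / b%:E)%E.
  by rewrite ediv_EFin ?gt_eqF// mulfK ?gt_eqF.
by rewrite inver gt_eqF// lee_wpmul2r// lee_fin invr_ge0 ltW.
Qed.

(** The pointwise bound is written without subtraction because the integral of
[f] may be infinite. *)
Lemma integral_ge_combination d (T : measurableType d) (R : realType)
    (P : {measure set T -> \bar R}) (f g h : T -> R)
    (G H a1 b1 a2 b2 : R) :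
  measurable_fun [set: T] f -> measurable_fun [set: T] g ->
  measurable_fun [set: T] h ->
  (forall w, 0 <= f w) -> (forall w, 0 <= g w) -> (forall w, 0 <= h w) ->
  (\int[P]_w (g w)%:E = G%:E)%E -> (\int[P]_w (h w)%:E = H%:E)%E ->
  0 <= a1 -> 0 <= b1 -> 0 <= a2 -> 0 <= b2 ->
  (forall w, a1 * g w + b1 * h w <= f w + (a2 * g w + b2 * h w)) ->
  ((a1 * G + b1 * H - (a2 * G + b2 * H))%:E <= \int[P]_w (f w)%:E)%E.
Proof.
move=> mf mg mh f0 g0 h0 gG hH a10 b10 a20 b20 le_f.
have comb_ge0 a b w : 0 <= a -> 0 <= b -> 0 <= a * g w + b * h w.
  by move=> a0 b0; rewrite addr_ge0 ?mulr_ge0.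
have mcomb a b : measurable_fun [set: T] (fun w => a * g w + b * h w).
  by apply: measurable_funD; exact: measurable_funM.
have comb a b : 0 <= a -> 0 <= b ->
    (\int[P]_w (a * g w + b * h w)%:E = (a * G + b * H)%:E)%E.
  move=> a0 b0; under eq_integral do rewrite EFinD !EFinM.
  rewrite ge0_integralD//; last 4 first.
  - by move=> w _; rewrite -EFinM lee_fin mulr_ge0.
  - by apply: measurable_funeM; exact/measurable_EFinP.
  - by move=> w _; rewrite -EFinM lee_fin mulr_ge0.
  - by apply: measurable_funeM; exact/measurable_EFinP.
  rewrite !ge0_integralZl_EFin//; last 4 first.
  - by move=> w _; rewrite lee_fin.
  - exact/measurable_EFinP.
  - by move=> w _; rewrite lee_fin.
  - exact/measurable_EFinP.
  by rewrite gG hH.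
rewrite EFinB leeBlDr// -comb// -comb// -ge0_integralD//; last 4 first.
- by move=> w _; rewrite lee_fin.
- exact/measurable_EFinP.
- by move=> w _; rewrite lee_fin comb_ge0.
- exact/measurable_EFinP.
apply: ge0_le_integral => //.
- by move=> w _; rewrite lee_fin comb_ge0.
- exact/measurable_EFinP.
- by apply: emeasurable_funD; exact/measurable_EFinP.
- by move=> w _; rewrite -EFinD lee_fin.
Qed.

Section Q_bounds.
Context (R : realType) (r : nat).
Context d (T : measurableType d) (P : probability T R) (X : {RV P >-> R}).
Hypothesis hX : chi_square_distributed r X.

Let chi w := Num.sqrt (X w).
Local Notation N := (@chi_scale R r).

Let measurable_chi : measurable_fun [set: T] chi.
Proof.
apply: measurableT_comp => //; apply: continuous_measurable_fun.
exact: sqrt_continuous.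
Qed.

Let measurable_psi s k u :
  measurable_fun [set: T] (fun w => pospart_pow s k (rescale u (X w))).
Proof.
apply: (measurableT_comp (measurable_pospart_pow _ _)).
exact: (measurableT_comp (measurable_rescale u)).
Qed.

(** The competitor is the truncated cubic based at [t = u - 3 / u]; its value at
[u] is [(3 / u) ^ 3], hence the constant [27]. *)
Lemma Q_le u J : 2 <= u ->
  (\int[P]_w (pospart_pow 3 3 (rescale u (X w)))%:E = (N u * J)%:E)%E ->
  (Q P chi u <= (N u * (J / 27))%:E)%E.
Proof.
move=> u2 hJ; have u0 : 0 < u by lra.
pose t := u - 3 / u.
have t0 : 0 <= t.
  by rewrite /t subr_ge0 ler_pdivrMr//; nra.
pose f x := Num.max (x - t) 0 ^+ 3 + Num.max (- x - t) 0 ^+ 3.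
have fE x : 0 <= x -> f x = Num.max (x - t) 0 ^+ 3.
  move=> x0; rewrite /f [X in _ + X ^+ 3]max_r; last by lra.
  by rewrite expr0n/= addr0.
have fu : f u = 27 / u ^+ 3.
  rewrite fE ?ltW// (_ : u - t = 3 / u); last by rewrite /t; lra.
  by rewrite max_l ?divr_ge0 ?ltW// exprMn exprVn; congr (_ * _); ring.
have fu0 : 0 < f u by rewrite fu divr_gt0 ?exprn_gt0.
have fchi w : f (chi w) = (u ^- 3) * pospart_pow 3 3 (rescale u (X w)).
  rewrite fE ?sqrtr_ge0// /pospart_pow.
  have -> : rescale u (X w) + 3 = u * (chi w - t).
    by rewrite /rescale /t -/(chi w); field; lra.
  rewrite -{2}(mulr0 u) -maxr_pMr ?ltW// exprMn mulrA mulVf ?mul1r//.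
  by rewrite expf_neq0// gt_eqF.
have EE : ('E_P[f \o chi] = (u ^- 3 * (N u * J))%:E)%E.
  rewrite expectationE; under eq_integral do rewrite /= fchi EFinM.
  rewrite ge0_integralZl_EFin//; last 3 first.
  - by move=> w _; rewrite lee_fin pospart_pow_ge0.
  - exact/measurable_EFinP.
  - by rewrite invr_ge0 exprn_ge0 ?ltW.
  by rewrite hJ.
have -> : (N u * (J / 27))%:E = ('E_P[f \o chi] / (f u)%:E)%E.
  by rewrite EE ediv_EFin ?gt_eqF// fu; congr EFin; field; lra.
apply: ereal_inf_lbound; exists f => //; split => //.
exact: truncated_cubic_upconv.
Qed.

(** Take expectations in [upconv_minorant] with [b = k * (u * (chi - u) + s)_+]
and [k = J2 / J3], the value that maximizes the result when the terms in the
derivative [A] cancel. In general these terms add up to a nonnegative multiple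
of [J3 - s * J2]. *)
Lemma Q_ge u s J2 J3 : 0 < u -> 0 <= s <= u ^+ 2 -> 0 < J2 -> 0 < J3 ->
  s * J2 <= J3 ->
  (\int[P]_w (pospart_pow s 2 (rescale u (X w)))%:E = (N u * J2)%:E)%E ->
  (\int[P]_w (pospart_pow s 3 (rescale u (X w)))%:E = (N u * J3)%:E)%E ->
  ((N u * ((1 - s / u ^+ 2) ^+ 2 * (J2 ^+ 3 / J3 ^+ 2)))%:E <= Q P chi u)%E.
Proof.
move=> u0 /[dup] /andP[s0 _] su J20 J30 sJ h2 h3.
have N0 : 0 < N u := chi_scale_gt0 hX u0.
apply: le_ereal_inf_tmp => _ [f [Cf fu0] <-].
apply: lee_ediv_EFin => //; rewrite expectationE.
have [f1 [f2 [fE df df1 cf2 [f0 f20]]]] := C2upconv_derivatives Cf.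
have [A A0 minor] := upconv_minorant fE df df1 cf2 f0 f20 u0 su.
set v := (1 - s / u ^+ 2) ^+ 2 in minor *.
have v0 : 0 <= v by exact: sqr_ge0.
pose k := J2 / J3; have k0 : 0 < k by rewrite divr_gt0.
pose M w := Num.max (rescale u (X w) + s) 0.
have M0 w : 0 <= M w by rewrite le_max lexx orbT.
have q0 : 0 <= A / u by apply: divr_ge0 => //; exact: ltW.
have vk2 : 0 <= v * k ^+ 2 by rewrite mulr_ge0 ?sqr_ge0.
have bound w :
    v * k ^+ 2 * (3 * f u) * M w ^+ 2 + v * k ^+ 2 * (A / u) * M w ^+ 3
    <= f (chi w) + (v * k ^+ 2 * (s * (A / u)) * M w ^+ 2 +
         v * k ^+ 2 * (2 * k * f u) * M w ^+ 3).
  have h := minor (chi w) (k * M w) (sqrtr_ge0 _) (mulr_ge0 (ltW k0) (M0 w)).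
  have {}h : v * ((k * M w) ^+ 2 * (3 * f u + (chi w - u) * A) -
      2 * (k * M w) ^+ 3 * f u) <= f (chi w).
    apply: h; rewrite pmulr_rgt0// /M lt_max ltxx orbF => h.
    have : - s <= u * (chi w - u) by rewrite /rescale -/(chi w) in h; lra.
    by rewrite -ler_pdivrMl// mulrN mulrC; lra.
  have chiE : M w ^+ 2 * ((chi w - u) * A) = M w ^+ 2 * ((M w - s) * (A / u)).
    rewrite /M; have [_|_] := leP 0 (rescale u (X w) + s).
      by congr (_ * _); rewrite /rescale -/(chi w); field; lra.
    by rewrite expr0n/= !mul0r.
  rewrite -lerBlDr; apply: le_trans h; rewrite le_eqVlt; apply/orP; left.
  rewrite (_ : v * ((k * M w) ^+ 2 * _ - _) =
    v * k ^+ 2 * (3 * f u) * M w ^+ 2 +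
    v * k ^+ 2 * (M w ^+ 2 * ((chi w - u) * A)) -
    2 * v * k ^+ 3 * f u * M w ^+ 3); last by ring.
  by rewrite chiE; apply/eqP; ring.
have mf : measurable_fun [set: T] (fun w => f (chi w)).
  exact: measurableT_comp (upconv_measurable df) measurable_chi.
have fchi0 w : 0 <= f (chi w).
  by apply: (upconv_ge0 fE df df1 cf2 f0 f20); exact: sqrtr_ge0.
have fu_ge0 := ltW fu0.
have a1 : 0 <= v * k ^+ 2 * (3 * f u) by apply: mulr_ge0 => //; lra.
have b1 : 0 <= v * k ^+ 2 * (A / u) by exact: mulr_ge0.
have a2 : 0 <= v * k ^+ 2 * (s * (A / u)).
  by apply: mulr_ge0 => //; exact: mulr_ge0.
have b2 : 0 <= v * k ^+ 2 * (2 * k * f u).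
  by apply: mulr_ge0 => //; apply: mulr_ge0 => //; lra.
have le_E := integral_ge_combination mf (@measurable_psi s 2 u)
  (@measurable_psi s 3 u) fchi0 (fun w => pospart_pow_ge0 s 2 _)
  (fun w => pospart_pow_ge0 s 3 _) h2 h3 a1 b1 a2 b2 bound.
apply: le_trans le_E.
rewrite lee_fin -subr_ge0.
rewrite (_ : _ - _ = N u * (v * k ^+ 2) * (A / u) * (J3 - s * J2)); last first.
  by rewrite /k; field; apply/andP; split; lra.
apply: mulr_ge0; last by rewrite subr_ge0.
by apply: mulr_ge0 => //; apply: mulr_ge0 => //; exact: ltW.
Qed.

End Q_bounds.

(** The upper bound uses the third moment with [s = 3]. The lower bound uses the
second and third moments with [s = 3 - dl], where [dl] is so small that
[2 * exp s / 9] exceeds [2 * exp 3 / 9 - e / 2]. *)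
Lemma Q_tail_bounds (R : realType) (r : nat) d (T : measurableType d)
    (P : probability T R) (X : {RV P >-> R}) (e : R) :
  chi_square_distributed r X -> 0 < e ->
  let chi w := Num.sqrt (X w) in
  \forall u \near +oo, exists t : R,
    [/\ 0 < t, P [set w | u <= chi w] = t%:E,
        (((2 * expR 3 / 9 - e) * t)%:E <= Q P chi u)%E &
        (Q P chi u <= ((2 * expR 3 / 9 + e) * t)%:E)%E].
Proof.
move=> hX e0 chi; set l := 2 * expR 3 / 9.
have l0 : 0 < l by have := @expR_gt0 R 3; rewrite /l; lra.
pose dl := Num.min 1 (e / (2 * l)).
have dl0 : 0 < dl by rewrite lt_min ltr01 divr_gt0// mulr_gt0.
have dl1 : dl <= 1 by rewrite ge_min lexx.
have dl_le : l * dl <= e / 2.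
  rewrite -ler_pdivlMl// (_ : l^-1 * (e / 2) = e / (2 * l)); last by field; lra.
  by rewrite ge_min lexx orbT.
pose s := 3 - dl.
have s0 : 0 <= s by rewrite /s; lra.
have l_le : l - e / 2 <= 2 * expR s / 9.
  have : l * (1 - dl) <= l * expR (- dl).
    by rewrite ler_pM2l//; exact: expR_ge1Dx.
  have -> : l * expR (- dl) = 2 * expR s / 9.
    by rewrite /s expRD /l; ring.
  by lra.
have s0' : 0 < expR s := expR_gt0 s.
have f3 : (3`! = 6)%N by [].
have f2 : (2`! = 2)%N by [].
have [J0 J0l hJ0] := tail_probability hX.
have [J3 J3l hJ3] := pospart_moment hX (ler0n R 3) (isT : 0 < 3)%N.
have [K2 K2l hK2] := pospart_moment hX s0 (isT : 0 < 2)%N.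
have [K3 K3l hK3] := pospart_moment hX s0 (isT : 0 < 3)%N.
have up : J3 u / 27 / J0 u @[u --> +oo] --> l.
  rewrite (_ : l = 2 * 3`!%:R * expR 3 / 27 / 2).
    apply: cvgM; first exact: cvgMr_tmp.
    by apply: cvgV.
  by rewrite /l f3; field.
have v1 : ((1 - s / u ^+ 2) ^+ 2 : R) @[u --> +oo] --> (1 : R).
  have h : (1 - s / u ^+ 2 : R) @[u --> +oo] --> (1 : R).
    rewrite -[X in _ --> X]subr0; apply: cvgB; first exact: cvg_cst.
    exact: div_sqr_cvgy.
  rewrite -[X in _ --> X](expr1n _ 2).
  exact: cvg_comp _ _ h (@exprn_continuous R 2 1).
have lo : (1 - s / u ^+ 2) ^+ 2 * (K2 u ^+ 3 / K3 u ^+ 2) / J0 u @[u --> +oo]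
    --> 2 * expR s / 9.
  rewrite (_ : 2 * expR s / 9 = 1 * ((2 * 2`!%:R * expR s) ^+ 3 /
      (2 * 3`!%:R * expR s) ^+ 2) / 2); last first.
    by rewrite f3 f2; field; lra.
  apply: cvgM; last by apply: cvgV.
  apply: cvgM; first exact: v1.
  apply: cvgM; first exact: cvg_comp _ _ K2l (@exprn_continuous R 3 _).
  apply: cvgV; first by rewrite expf_neq0// gt_eqF// !mulr_gt0// ltr0n fact_gt0.
  exact: cvg_comp _ _ K3l (@exprn_continuous R 2 _).
have gap : K3 u - s * K2 u @[u --> +oo] --> 4 * dl * expR s.
  rewrite (_ : 4 * dl * expR s =
      2 * 3`!%:R * expR s - s * (2 * 2`!%:R * expR s)).
    by apply: cvgB => //; exact: cvgMl_tmp.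
  by rewrite f3 f2 /s; ring.
near=> u.
have u2 : 2 <= u by [].
have us : s <= u by [].
have u0 : 0 < u by lra.
have J00 : 0 < J0 u by near: u; apply: (cvgr_gt 2).
have K20 : 0 < K2 u.
  near: u; apply: (cvgr_gt _ K2l).
  by rewrite !mulr_gt0// ltr0n fact_gt0.
have K30 : 0 < K3 u.
  near: u; apply: (cvgr_gt _ K3l).
  by rewrite !mulr_gt0// ltr0n fact_gt0.
have N0 : 0 < @chi_scale R r u := chi_scale_gt0 hX u0.
exists (chi_scale r u * J0 u); split.
- exact: mulr_gt0.
- by near: u.
- apply: (@le_trans _ _ (chi_scale r u * ((1 - s / u ^+ 2) ^+ 2 *
    (K2 u ^+ 3 / K3 u ^+ 2)))%:E).
    rewrite lee_fin mulrCA ler_pM2l// -ler_pdivlMr//.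
    near: u; apply: (cvgr_ge _ lo); lra.
  apply: (Q_ge hX) => //.
  + by rewrite s0/= (le_trans us)// expr2 ler_peMr//; lra.
  + rewrite -subr_ge0; near: u; apply: (cvgr_ge _ gap).
    by rewrite !mulr_gt0.
  + by near: u.
  + by near: u.
- apply: (@le_trans _ _ (chi_scale r u * (J3 u / 27))%:E).
    have h3 : (\int[P]_w (pospart_pow 3 3 (rescale u (X w)))%:E =
        (chi_scale r u * J3 u)%:E)%E by near: u.
    exact: (Q_le u2 h3).
  rewrite lee_fin [X in _ <= X]mulrCA ler_pM2l// -ler_pdivrMr//.
  near: u; apply: (cvgr_le _ up); lra.
Unshelve. all: by end_near. Qed.

Unset Implicit Arguments.

Theorem proposition4p8 (R : realType) (r : nat) (hr : (1 <= r)%N)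
    (d : measure_display) (T : measurableType d) (P : probability T R)
    (X : {RV P >-> R}) (hX : chi_square_distributed r X) :
  let chi : T -> R := fun w => Num.sqrt (X w) in
  ((Q P chi u / P [set w | (u <= chi w)%R])%E @[u --> +oo]
     --> (2 * expR 3 / 9)%:E) /\
  (forall c : R,
    (forall u : R, 0 <= u -> (Q P chi u < c%:E * P [set w | (u <= chi w)%R])%E) ->
    2 * expR 3 / 9 <= c).
Proof.
move=> chi; split.
  have ratio (e : R) : 0 < e -> \forall u \near +oo,
      exists2 q : R, (Q P chi u / P [set w | (u <= chi w)%R])%E = q%:E &
        2 * expR 3 / 9 - e <= q <= 2 * expR 3 / 9 + e.
    move=> e0; apply: filterS (Q_tail_bounds hX e0) => u [t [t0 ->]].
    case: (Q P chi u) => [q| |]; rewrite ?leye_eq ?leeNy_eq// !lee_fin => lo up.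
    exists (q / t); first by rewrite ediv_EFin// gt_eqF.
    by rewrite ler_pdivlMr// ler_pdivrMr// lo.
  apply/fine_cvgP; split.
    by apply: filterS (ratio 1 ltr01) => u [q -> _].
  apply/cvgrPdist_le => e e0.
  apply: filterS (ratio e e0) => u [q /= -> /andP[lo up]].
  by rewrite /= ler_norml; apply/andP; split; lra.
move=> c hc; apply/ler_addgt0Pr => e e0.
have ev : \forall u \near +oo, 0 <= u /\ (exists t : R,
    [/\ 0 < t, P [set w | u <= chi w] = t%:E,
        (((2 * expR 3 / 9 - e) * t)%:E <= Q P chi u)%E &
        (Q P chi u <= ((2 * expR 3 / 9 + e) * t)%:E)%E]).
  apply: filterI; first exact: nbhs_pinfty_ge.
  exact: Q_tail_bounds hX e0.
have [u [u0 [t [t0 Pt lo _]]]] := filter_ex ev.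
have := le_lt_trans lo (hc u u0).
rewrite Pt -EFinM lte_fin ltr_pM2r// => h.
by lra.
Qed.
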